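(* Let $F=u\,\phi(r,s)$ be a spherically symmetric Finsler surface (dimension $n=2$) on $\mathbb{B}^2(r_0)\subset\mathbb{R}^2$. At every $(x,y)$ with $x,y$ linearly independent, put $$a=\sqrt{\frac{\phi\,(\phi-s\phi_s+(r^2-s^2)\phi_{ss})}{r^2-s^2}},\qquad m_i=a\,n_i,\qquad m^i=g^{ij}m_j ,$$ where $n_i=x_i-\frac{s}{u}y_i$. Then $(\ell^i,m^i)$ with $$\ell^i=\frac{y^i}{F},\qquad m^i=a\Bigl(\rho_0\,\mathbf{n}^i+\frac{r^2-s^2}{u}\,(\rho_2\,y^i+u\,\rho_3\,x^i)\Bigr)$$ is an orthonormal frame with respect to $g_{ij}$ (that is, $g_{ij}\ell^i\ell^j=1$, $g_{ij}m^im^j=1$, $g_{ij}\ell^im^j=0$); it is the Berwald frame of the surface.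
   Context: Notation: for $x\in\mathbb{B}^2(r_0)$ (the open disc of radius $r_0$ centred at $0$) and $y\in\mathbb{R}^2\setminus\{0\}$ put $r=|x|$, $u=|y|$, $s=\langle x,y\rangle/|y|$ (Euclidean norm and inner product). Subscripts $s$ denote partial derivatives. Indices of $x$ and $y$ are lowered with the Kronecker delta: $x_i=x^i$, $y_i=y^i$. Summation over repeated indices. A spherically symmetric Finsler metric is $F=u\,\phi(r,s)$ with $\phi$ positive and smooth (for $|s|\le r<r_0$), and, in dimension 2, regular: $\phi-s\phi_s+(r^2-s^2)\phi_{ss}>0$ for all $|s|\le r<r_0$. Its metric tensor is $g_{ij}=\frac12\frac{\partial^2F^2}{\partial y^i\partial y^j}$ with inverse $g^{ij}$. Set $n_i=x_i-\frac{s}{u}y_i$, $\mathbf{n}^i=\delta^{ij}n_j=x^i-\frac{s}{u}y^i$, and $$\rho_0=\frac{1}{\phi(\phi-s\phi_s)},\quad \rho_2=-\frac{\phi\phi_s-s\phi_s^2-s\phi\phi_{ss}}{\phi^2(\phi-s\phi_s)(\phi-s\phi_s+(r^2-s^2)\phi_{ss})},\quad \rho_3=-\frac{\phi_{ss}}{\phi(\phi-s\phi_s)(\phi-s\phi_s+(r^2-s^2)\phi_{ss})}.$$ The Berwald frame of a (positive definite) Finsler surface is the frame $(\ell^i,m^i)$ with $\ell^i=y^i/F$ and $m^i$ a $g$-unit vector that is $g$-orthogonal to $\ell^i$. *)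

(* Defs.v *)
From HB Require Import structures.
From mathcomp Require Import all_boot all_order all_algebra.
From mathcomp Require Import all_classical all_reals all_analysis.
Import Order.TTheory GRing.Theory Num.Theory.
Import numFieldNormedType.Exports.
Set Implicit Arguments.
Unset Strict Implicit.
Unset Printing Implicit Defensive.
Local Open Scope classical_set_scope.
Local Open Scope ring_scope.

Section Defs.
Context {R : realType}.

(* The library norm `|x| on 'rV[R]_2 is the sup norm, so the Euclidean
   structure is introduced separately. *)
Definition dot (x y : 'rV[R]_2) : R := \sum_i x 0 i * y 0 i.
Definition enorm (x : 'rV[R]_2) : R := Num.sqrt (dot x x).

Definition partial_r (f : R -> R -> R) : R -> R -> R :=
  fun r s => derive1 (fun t => f t s) r.
Definition partial_s (f : R -> R -> R) : R -> R -> R :=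
  fun r s => derive1 (f r) s.

(* All iterated partial derivatives of f of order at most n exist and are
   continuous on U, which is meant to be open. *)
Fixpoint Cn_on (n : nat) (U : set (R * R)) (f : R -> R -> R) : Prop :=
  (forall p, U p -> {for p, continuous (fun q : R * R => f q.1 q.2)}) /\
  match n with
  | 0%N => True
  | m.+1 =>
      [/\ forall p, U p -> derivable (fun t => f t p.2) p.1 1
                           /\ derivable (f p.1) p.2 1,
          Cn_on m U (partial_r f)
        & Cn_on m U (partial_s f)]
  end.

(* As usual for a set that need not be open: smooth on an open neighbourhood. *)
Definition smooth_on (D : set (R * R)) (f : R -> R -> R) : Prop :=
  exists U : set (R * R), [/\ open U, D `<=` U & forall n, Cn_on n U f].

Definition rs_domain (r0 : R) : set (R * R) :=
  [set p | `|p.2| <= p.1 /\ p.1 < r0].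

Section Phi.
Variables (phi : R -> R -> R) (r s : R).
Let p := phi r s.
Let ps := partial_s phi r s.
Let pss := partial_s (partial_s phi) r s.

Definition regularity_expr : R := p - s * ps + (r ^+ 2 - s ^+ 2) * pss.

Definition rho0 : R := 1 / (p * (p - s * ps)).

Definition rho2 : R :=
  - ((p * ps - s * ps ^+ 2 - s * p * pss)
     / (p ^+ 2 * (p - s * ps) * (p - s * ps + (r ^+ 2 - s ^+ 2) * pss))).

Definition rho3 : R :=
  - (pss / (p * (p - s * ps) * (p - s * ps + (r ^+ 2 - s ^+ 2) * pss))).

Definition acoef : R :=
  Num.sqrt (p * (p - s * ps + (r ^+ 2 - s ^+ 2) * pss) / (r ^+ 2 - s ^+ 2)).

End Phi.

(* phi is a total function, but only its values near rs_domain r0 matter. *)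
Definition spherically_symmetric_finsler_surface
    (r0 : R) (phi : R -> R -> R) : Prop :=
  [/\ smooth_on (rs_domain r0) phi,
      forall r s, rs_domain r0 (r, s) -> 0 < phi r s
    & forall r s, rs_domain r0 (r, s) -> 0 < regularity_expr phi r s].

Definition svar (x y : 'rV[R]_2) : R := dot x y / enorm y.

Definition sphF (phi : R -> R -> R) (x y : 'rV[R]_2) : R :=
  enorm y * phi (enorm x) (svar x y).

Definition partial_y (i : 'I_2) (f : 'rV[R]_2 -> R) : 'rV[R]_2 -> R :=
  fun y => 'D_(delta_mx 0 i) f y.

Definition metric_tensor (F : 'rV[R]_2 -> 'rV[R]_2 -> R) (x y : 'rV[R]_2) :
    'M[R]_2 :=
  \matrix_(i, j)
    (2^-1 * partial_y i (partial_y j (fun w => F x w ^+ 2)) y).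

Definition gform (g : 'M[R]_2) (v w : 'rV[R]_2) : R :=
  \sum_i \sum_j g i j * v 0 i * w 0 j.

Definition positive_definite (g : 'M[R]_2) : Prop :=
  forall v : 'rV[R]_2, v != 0 -> 0 < gform g v v.

Definition raise (g : 'M[R]_2) (w : 'rV[R]_2) : 'rV[R]_2 :=
  \row_i \sum_j invmx g i j * w 0 j.

Definition orthonormal_frame (g : 'M[R]_2) (l m : 'rV[R]_2) : Prop :=
  free [:: l; m] /\
  [/\ gform g l l = 1, gform g m m = 1 & gform g l m = 0].

(* The frame is determined only up to the sign of m. *)
Definition berwald_frame (F : 'rV[R]_2 -> 'rV[R]_2 -> R)
    (x y l m : 'rV[R]_2) : Prop :=
  let g := metric_tensor F x y in
  [/\ positive_definite g, free [:: l; m], l = (F x y)^-1 *: y,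
      gform g m m = 1 & gform g l m = 0].

(* Indices of x and y are moved with the Kronecker delta, so the covector n_i
   and the vector n^i have the same components. *)
Definition nvec (x y : 'rV[R]_2) : 'rV[R]_2 :=
  x - (svar x y / enorm y) *: y.

End Defs.

(* Main.v *)
(** For |s| < r the function h(s) = phi - s phi_s is positive: at an interior
    minimum on [-r, r] either s = 0, where h = phi, or h' = - s phi_ss = 0, so
    that phi_ss = 0; there, and at s = +-r, h is the regularity expression.
    Since ds/dy^i = n_i / u, differentiating F^2 twice gives
    g_ij = l_i l_j + phi (phi - s phi_s) (delta_ij - y_i y_j / u^2)
           + phi phi_ss n_i n_j,   l_i = phi y_i / u + phi_s n_i.
    In dimension 2, n_i n_j = (r^2 - s^2) (delta_ij - y_i y_j / u^2), so
    g_ij = l_i l_j + m_i m_j with m_i = a n_i, and (l^i, m^i) is the frame dual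
    to the coframe (l_i, m_i). *)
Require Import Defs.
From HB Require Import structures.
From mathcomp Require Import all_boot all_order all_algebra.
From mathcomp Require Import all_classical all_reals all_analysis.
From mathcomp Require Import ring lra.
Import Order.TTheory GRing.Theory Num.Theory.
Import numFieldNormedType.Exports.
Set Implicit Arguments.
Unset Strict Implicit.
Unset Printing Implicit Defensive.
Local Open Scope ring_scope.

(** * Directional derivatives and the chain rule along a line *)

Lemma is_derive_lineP (R : numFieldType) (V W : normedModType R) (f : V -> W)
    (a v : V) (d : W) :
  is_derive (0 : R) (1 : R) (fun t : R => f (a + t *: v)) d
  <-> is_derive a v f d.
Proof.
(* At [0] in direction [1], the difference quotient of the restriction of [f] to the line is that of
   [f] at [a] in direction [v]. *)
have E : (fun h : R => h^-1 *: (((fun t : R => f (a + t *: v)) \o shift 0)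
            (h *: 1) - f (a + 0 *: v)))
         = (fun h : R => h^-1 *: ((f \o shift a) (h *: v) - f a)).
  apply/funext => h /=.
  by rewrite scale0r !addr0 [h *: 1]mulr1 [a + _]addrC.
by split=> -[dfl dfv]; split; move: dfl dfv; rewrite /derivable /derive E.
Qed.

(** Restricting [g] to the line through [a] in direction [v] reduces this to the one-variable chain
    rule, so [g] is differentiated along [v] only. *)
Lemma is_derive_comp1 (R : realType) (V : normedModType R) (g : V -> R)
    (f : R -> R) (a v : V) (b c : R) :
  is_derive a v g b -> is_derive (g a) 1 f c ->
  is_derive a v (f \o g) (c * b).
Proof.
move=> /is_derive_lineP gb fc; apply/is_derive_lineP.
apply: (@is_derive1_comp _ f (fun t : R => g (a + t *: v))) => //.
by rewrite scale0r addr0.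
Qed.

Lemma is_derive_coord (R : realType) (n : nat) (i : 'I_n.+1)
    (a v : 'rV[R]_n.+1) :
  is_derive a v (fun w : 'rV[R]_n.+1 => w 0 i) (v 0 i).
Proof.
apply/is_derive_lineP.
have -> : (fun t : R => (a + t *: v) 0 i) = (fun t : R => a 0 i + v 0 i *: t).
  by apply/funext => t /=; rewrite !mxE mulrC.
refine (is_derive_eq (is_deriveD (is_derive_cst (a 0 i : R) (0 : R) (1 : R))
  (is_deriveZ (v 0 i) (is_derive_id (0 : R) 1))) _).
by rewrite add0r [_ *: _]mulr1.
Qed.

Lemma forall_I2 (P : 'I_2 -> Prop) : P 0 -> P 1 -> forall i, P i.
Proof.
move=> P0 P1 [[|[|//]] i]; first by rewrite (_ : Ordinal i = 0)//; apply/val_inj.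
by rewrite (_ : Ordinal i = 1)//; apply/val_inj.
Qed.

(** * Euclidean geometry of the plane *)

Section Euclid.
Context {R : realType}.
Implicit Types x y v w : 'rV[R]_2.

Lemma dotE x y : dot x y = x 0 0 * y 0 0 + x 0 1 * y 0 1.
Proof.
rewrite /dot !big_ord_recl big_ord0 addr0.
by congr (_ + x 0 _ * y 0 _); apply/val_inj.
Qed.

Lemma dot_gt0 w : w != 0 -> 0 < dot w w.
Proof.
move=> w0; rewrite dotE lt_neqAle -!expr2 addr_ge0 ?sqr_ge0// andbT eq_sym.
apply: contra w0; rewrite paddr_eq0 ?sqr_ge0// !sqrf_eq0 => /andP[/eqP w0 /eqP w1].
by apply/eqP/rowP; apply: forall_I2; rewrite mxE.
Qed.

Lemma enorm_gt0 w : w != 0 -> 0 < enorm w.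
Proof. by move=> w0; rewrite sqrtr_gt0 dot_gt0. Qed.

Lemma sqr_enorm w : enorm w ^+ 2 = dot w w.
Proof. by rewrite sqr_sqrtr// dotE -!expr2 addr_ge0 ?sqr_ge0. Qed.

Lemma dot_svar x w : w != 0 -> dot x w = svar x w * enorm w.
Proof. by move=> /enorm_gt0 w0; rewrite /svar divfK// gt_eqF. Qed.

(** The determinant with rows [x] and [y]; it measures linear independence. *)
Definition cross x y : R := x 0 0 * y 0 1 - x 0 1 * y 0 0.

(** Lagrange's identity. It yields both the Cauchy-Schwarz bound [svar_le] and its strict form
    [svar_lt]. *)
Lemma sqr_cross x w : w != 0 ->
  (enorm x ^+ 2 - svar x w ^+ 2) * enorm w ^+ 2 = cross x w ^+ 2.
Proof.
move=> w0; rewrite mulrBl -[svar x w ^+ 2 * _]exprMn -dot_svar// !sqr_enorm.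
by rewrite /cross !dotE; ring.
Qed.

Lemma svar_le x w : w != 0 -> `|svar x w| <= enorm x.
Proof.
move=> w0; rewrite -(ger0_norm (sqrtr_ge0 _ : 0 <= enorm x)) -ler_sqr ?nnegrE//.
rewrite !real_normK ?num_real// -subr_ge0.
by rewrite -(pmulr_lge0 _ (exprn_gt0 2 (enorm_gt0 w0))) sqr_cross ?sqr_ge0.
Qed.

Lemma svar_lt x w : w != 0 -> cross x w != 0 ->
  0 < enorm x ^+ 2 - svar x w ^+ 2.
Proof.
move=> w0 c0; rewrite -(pmulr_lgt0 _ (exprn_gt0 2 (enorm_gt0 w0))) sqr_cross//.
by rewrite exprn_even_gt0.
Qed.

Lemma free2P x y : reflect (forall a b, a *: x + b *: y = 0 -> a = 0 /\ b = 0)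
  (free [:: x; y]).
Proof.
rewrite free_cons seq1_free span_seq1; apply: (iffP andP) => [[xy y0] a b|H].
  have [->|a0] := eqVneq a 0.
    by rewrite scale0r add0r => /eqP; rewrite scaler_eq0 (negbTE y0) orbF => /eqP.
  move=> /eqP; rewrite addr_eq0 => /eqP E; case/negP: xy; apply/vlineP.
  exists (- (a^-1 * b)); rewrite scaleNr -scalerA -scalerN -E.
  by rewrite scalerA mulVf// scale1r.
split.
  apply/negP => /vlineP[k E]; have [] := H 1 (- k).
    by rewrite E scale1r scaleNr subrr.
  by move/eqP; rewrite oner_eq0.
apply/eqP => y0; have [] := H 0 1; first by rewrite y0 scale0r scaler0 addr0.
by move=> _ /eqP; rewrite oner_eq0.
Qed.

Lemma free_cross x y : free [:: x; y] -> y != 0 /\ cross x y != 0.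
Proof.
move=> /[dup]; rewrite {1}free_cons seq1_free => /andP[_ y0] /free2P H.
split=> //; apply/negP => /eqP c0; move: (y0); apply/negP/negPn.
have H2 a b : (forall i, a * x 0 i + b * y 0 i = 0) -> a = 0.
  by move=> ab; apply: (proj1 (H a b _)); apply/rowP => i; rewrite !mxE.
apply/eqP/rowP => i; rewrite mxE.
(* If the determinant vanishes, then [y_i x - x_i y = 0] for each index [i], and independence forces
   [y_i = 0]. *)
apply: (H2 _ (- x 0 i)) => j; move: c0; rewrite /cross.
by move: i j; apply: forall_I2; apply: forall_I2 => c0; lra.
Qed.

End Euclid.

(** * Derivatives of u and s with respect to y *)

Section Deriv.
Context {R : realType}.
Implicit Types x y v w : 'rV[R]_2.

Lemma is_derive_dot x w v : is_derive w v (dot x) (dot x v).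
Proof.
rewrite dotE (_ : dot x = fun w => x 0 0 *: w 0 0 + x 0 1 *: w 0 1); last first.
  by apply/funext => z; rewrite dotE.
apply: (is_deriveD (is_deriveZ _ (is_derive_coord _ _ _))
  (is_deriveZ _ (is_derive_coord _ _ _))).
Qed.

Lemma is_derive_enorm w v : w != 0 ->
  is_derive w v enorm (dot w v / enorm w).
Proof.
move=> w0; have u0 := enorm_gt0 w0.
have dQ : is_derive w v (fun w => dot w w) (2 * dot w v).
  have -> : (fun w => dot w w) = fun w => w 0 0 * w 0 0 + w 0 1 * w 0 1.
    by apply/funext => z; rewrite dotE.
  refine (is_derive_eq (is_deriveD
    (is_deriveM (is_derive_coord _ _ _) (is_derive_coord _ _ _))
    (is_deriveM (is_derive_coord _ _ _) (is_derive_coord _ _ _))) _).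
  by rewrite dotE /GRing.scale /=; ring.
refine (is_derive_eq (is_derive_comp1 dQ
  (is_derive1_sqrt (dot_gt0 w0))) _).
by rewrite -/(enorm w); field; rewrite gt_eqF.
Qed.

Lemma dot_nvec x w v :
  dot (nvec x w) v = dot x v - svar x w / enorm w * dot w v.
Proof. by rewrite !dotE !mxE; ring. Qed.

Lemma is_derive_svar x w v : w != 0 ->
  is_derive w v (svar x) (dot (nvec x w) v / enorm w).
Proof.
move=> w0; have u0 := enorm_gt0 w0.
have dV : is_derive w v (fun w => (enorm w)^-1)
    (- enorm w ^- 2 * (dot w v / enorm w)).
  apply: (is_derive_comp1 (f := fun t : R => t^-1)
    (is_derive_enorm v w0)).
  apply: is_derive_eq.
    by apply: (@is_deriveV _ id); rewrite ?gt_eqF.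
  by rewrite [_ *: _]mulr1.
refine (is_derive_eq (is_deriveM (is_derive_dot x w v) dV) _).
rewrite dot_nvec /svar /GRing.scale /=; field; rewrite ?gt_eqF//.
Qed.

End Deriv.

(** * The metric tensor as half the Hessian of F^2 *)

Section Metric.
Context {R : realType}.
Variables (x : 'rV[R]_2) (phi : R -> R -> R).
Let r := enorm x.
(** With [x] fixed, [r] is constant and only derivatives in s enter, over the range given by
    [svar_le]. *)
Hypothesis dphi : forall s : R, `|s| <= r -> derivable (phi r) s 1.
Hypothesis ddphi : forall s : R, `|s| <= r -> derivable (partial_s phi r) s 1.
Implicit Types v w y : 'rV[R]_2.

Local Notation p w := (phi r (svar x w)).
Local Notation ps w := (partial_s phi r (svar x w)).
Local Notation pss w := (partial_s (partial_s phi) r (svar x w)).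

Lemma is_derive_phi w v : w != 0 ->
  is_derive w v (fun w => p w) (ps w * (dot (nvec x w) v / enorm w)).
Proof.
move=> w0; apply: (is_derive_comp1 (is_derive_svar x v w0)).
by rewrite /partial_s derive1E; apply: DeriveDef => //; apply/dphi/svar_le.
Qed.

Lemma is_derive_dphi w v : w != 0 ->
  is_derive w v (fun w => ps w) (pss w * (dot (nvec x w) v / enorm w)).
Proof.
move=> w0; apply: (is_derive_comp1 (is_derive_svar x v w0)).
by rewrite {2}/partial_s derive1E; apply: DeriveDef => //; apply/ddphi/svar_le.
Qed.

(** Writing u n·v as u x·v - s w·v removes every division by u, so the second differentiation needs
    only sums and products of known derivatives. *)
Lemma is_derive_sphF2 w v : w != 0 ->
  is_derive w v (fun w => sphF phi x w ^+ 2)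
    (2 * (p w ^+ 2 * dot w v
          + p w * ps w * (enorm w * dot x v - svar x w * dot w v))).
Proof.
move=> w0; have u0 := enorm_gt0 w0.
refine (is_derive_eq (is_deriveX 2
  (is_deriveM (is_derive_enorm v w0) (is_derive_phi v w0))) _).
rewrite dot_nvec /GRing.scale /= !fctE expr1; field; rewrite gt_eqF//.
Qed.

Lemma partial_partial_sphF2 (i j : 'I_2) y : y != 0 ->
  2^-1 * partial_y i (partial_y j (fun w => sphF phi x w ^+ 2)) y =
  (p y * y 0 i / enorm y + ps y * nvec x y 0 i)
    * (p y * y 0 j / enorm y + ps y * nvec x y 0 j)
  + p y * (p y - svar x y * ps y)
      * ((i == j)%:R - y 0 i * y 0 j / enorm y ^+ 2)
  + p y * pss y * nvec x y 0 i * nvec x y 0 j.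
Proof.
move=> y0; have u0 := enorm_gt0 y0.
have dot_delta (z : 'rV[R]_2) k : dot z (delta_mx 0 k) = z 0 k.
  rewrite /dot (bigD1 k)//= big1 ?addr0 ?mxE ?eqxx ?mulr1// => l /negbTE lk.
  by rewrite mxE lk andbF mulr0.
rewrite /partial_y.
(* The first derivative is known only away from the origin; a whole neighbourhood of [y] avoids it,
   which is enough to differentiate again at [y]. *)
have -> : 'D_(delta_mx 0 i)
    ('D_(delta_mx 0 j) (fun w => sphF phi x w ^+ 2)) y
  = 'D_(delta_mx 0 i) (fun w => 2 * (p w ^+ 2 * w 0 j
      + p w * ps w * (enorm w * x 0 j - svar x w * w 0 j))) y.
  apply: near_eq_derive; near=> w.
  have w0 : w != 0 by near: w; apply: (cvgr_neq0 _ _ y0).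
  have := is_derive_sphF2 (delta_mx 0 j) w0; rewrite !dot_delta => H.
  exact: derive_val.
pose v : 'rV[R]_2 := delta_mx 0 i.
have dj := is_derive_coord j y v.
have dp := is_derive_phi v y0.
have dps := is_derive_dphi v y0.
have H := is_deriveZ 2 (is_deriveD (is_deriveM (is_deriveX 2 dp) dj)
  (is_deriveM (is_deriveM dp dps)
     (is_deriveB (is_deriveM (is_derive_enorm v y0) (is_derive_cst (x 0 j) y v))
                 (is_deriveM (is_derive_svar x v y0) dj)))).
rewrite (derive_val (is_derive := H)) !dot_delta.
rewrite mxE eqxx /= [j == i]eq_sym !mxE /GRing.scale /= !fctE /= expr1.
by case: (i == j) => /=; field; rewrite gt_eqF.
Unshelve. all: by end_near. Qed.

End Metric.

(** * Linear algebra of a coframe and its dual frame *)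

Section Coframe.
Context {R : realType}.
Implicit Types (v w L M l m : 'rV[R]_2) (g : 'M[R]_2).

Lemma dotDr v w L : dot L (v + w) = dot L v + dot L w.
Proof. by rewrite !dotE !mxE; ring. Qed.

Lemma dotZr a v L : dot L (a *: v) = a * dot L v.
Proof. by rewrite !dotE !mxE; ring. Qed.

Lemma dotC v w : dot v w = dot w v.
Proof. by rewrite !dotE; ring. Qed.

Lemma mulmx_dot v w : v *m w^T = (dot v w)%:M.
Proof.
by apply/rowP => i; rewrite ord1 !mxE mulr1n; apply: eq_bigr => j _; rewrite mxE.
Qed.

Lemma gform_mx g v w : (gform g v w)%:M = v *m g *m w^T.
Proof.
apply/rowP => k; rewrite ord1 !mxE mulr1n /gform exchange_big.
apply: eq_bigr => j _; rewrite !mxE mulr_suml; apply: eq_bigr => i _.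
by rewrite [v 0 i * _]mulrC.
Qed.

Lemma gform_coframe L M v w :
  gform (L^T *m L + M^T *m M) v w = dot L v * dot L w + dot M v * dot M w.
Proof.
have: (gform (L^T *m L + M^T *m M) v w)%:M
      = (dot L v * dot L w + dot M v * dot M w)%:M :> 'M[R]_1.
  rewrite gform_mx mulmxDr !mulmxA mulmxDl -!mulmxA !mulmx_dot !mulmxA.
  by rewrite !mulmx_dot -!scalar_mxM -raddfD /= ![dot v _]dotC.
by move=> /matrixP/(_ 0 0); rewrite !mxE !mulr1n.
Qed.

Lemma positive_definite_unitmx g : positive_definite g -> g \in unitmx.
Proof.
move=> gpos; rewrite unitmxE unitfE; apply/negP => /det0P[v v0 vg].
have := gpos v v0; rewrite (_ : gform g v v = 0) ?ltxx//.
have := gform_mx g v v; rewrite vg mul0mx.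
by move=> /matrixP/(_ 0 0); rewrite !mxE mulr1n.
Qed.

Lemma raise_mx g v : raise g v = (invmx g *m v^T)^T.
Proof. by apply/rowP => i; rewrite !mxE; apply: eq_bigr => j _; rewrite mxE. Qed.

(** The four pairings say that the matrix with rows [L], [M] is inverse to the one with columns [l],
    [m]. No inverse of [g] has to be computed: [g] sends [m] to [M], so raising [M] returns [m]. *)
Lemma dual_coframe L M l m (g := L^T *m L + M^T *m M) :
  dot L l = 1 -> dot M l = 0 -> dot L m = 0 -> dot M m = 1 ->
  [/\ positive_definite g, raise g M = m & orthonormal_frame g l m].
Proof.
move=> Ll Ml Lm Mm.
have LM : cross L M * cross l m = 1.
  transitivity (dot L l * dot M m - dot L m * dot M l).
    by rewrite /cross !dotE; ring.
  by rewrite Ll Ml Lm Mm; ring.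
have gpos : positive_definite g.
  move=> v; rewrite gform_coframe -!expr2 lt_neqAle addr_ge0 ?sqr_ge0// andbT.
  apply: contra => /eqP/esym/eqP; rewrite paddr_eq0 ?sqr_ge0// !sqrf_eq0.
  (* Cramer's rule recovers [v] from its pairings with [L] and [M]; [cross l m] is the inverse of
     the determinant [cross L M]. *)
  move=> /andP[/eqP Lv /eqP Mv]; apply/eqP/rowP; apply: forall_I2; rewrite mxE.
    transitivity (cross l m * (dot L v * M 0 1 - dot M v * L 0 1)).
      by rewrite -[LHS]mul1r -LM /cross !dotE; ring.
    by rewrite Lv Mv; ring.
  transitivity (cross l m * (dot M v * L 0 0 - dot L v * M 0 0)).
    by rewrite -[LHS]mul1r -LM /cross !dotE; ring.
  by rewrite Lv Mv; ring.
split=> //.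
  rewrite raise_mx (_ : M^T = g *m m^T).
    by rewrite mulKmx ?trmxK// positive_definite_unitmx.
  by rewrite mulmxDl -!mulmxA !mulmx_dot Lm Mm !mul_mx_scalar scale0r scale1r add0r.
split; last by rewrite !gform_coframe Ll Ml Lm Mm; split; ring.
(* Pairing a linear relation with [L] and with [M] reads off its coefficients. *)
apply/free2P => a b E; split.
  have <- : dot L (a *: l + b *: m) = a by rewrite dotDr !dotZr Ll Lm; ring.
  by rewrite E dotE !mxE; ring.
have <- : dot M (a *: l + b *: m) = b by rewrite dotDr !dotZr Ml Mm; ring.
by rewrite E dotE !mxE; ring.
Qed.

End Coframe.

(** The vector n is orthogonal to [w] and has squared length r^2 - s^2, so in the plane its outer
    square is that multiple of the projection along [w]. Writing s/u and r^2 - s^2 through dot and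
    cross products removes the square roots and leaves a rational identity in coordinates. *)
Lemma nvec_outer (R : realType) (x w : 'rV[R]_2) (i j : 'I_2) : w != 0 ->
  nvec x w 0 i * nvec x w 0 j =
  (enorm x ^+ 2 - svar x w ^+ 2)
    * ((i == j)%:R - w 0 i * w 0 j / enorm w ^+ 2).
Proof.
move=> w0; have u0 : enorm w != 0 by rewrite gt_eqF ?enorm_gt0.
have Q0 : dot w w != 0 by rewrite gt_eqF ?dot_gt0.
have -> : enorm x ^+ 2 - svar x w ^+ 2 = cross x w ^+ 2 / dot w w.
  by rewrite -sqr_cross// (sqr_enorm w) mulfK.
have nE k : nvec x w 0 k = x 0 k - dot x w / dot w w * w 0 k.
  by rewrite !mxE -sqr_enorm /svar; congr (_ - _ * _); field.
rewrite !nE sqr_enorm /cross; move: i j Q0.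
by apply: forall_I2; apply: forall_I2; rewrite /= !dotE => Q0; field.
Qed.

(** * Positivity of phi - s phi_s *)

Lemma smooth_on_derivable_s (R : realType) (D : set (R * R))
    (phi : R -> R -> R) (r s : R) : smooth_on D phi -> D (r, s) ->
  derivable (phi r) s 1 /\ derivable (partial_s phi r) s 1.
Proof.
move=> [U [_ DU smU]] /DU Us.
by have [_ [/(_ _ Us)[_ ?] _ [_ [/(_ _ Us)[_ ?] _ _]]]] := smU 2%N.
Qed.

(** This factor occurs in the denominators of [rho0], [rho2] and [rho3]. It is bounded below by its
    minimum over s in [-r, r]. *)
Lemma finsler_sub_s_partial_gt0 (R : realType) (r0 : R)
    (phi : R -> R -> R) (r s : R) :
  spherically_symmetric_finsler_surface r0 phi -> `|s| <= r -> r < r0 ->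
  0 < phi r s - s * partial_s phi r s.
Proof.
move=> [sm phi0 reg0] sr rr0.
pose h t := phi r t - t * partial_s phi r t.
have dh (t : R) : `|t| <= r ->
    is_derive t 1 h (- (t * partial_s (partial_s phi) r t)).
  move=> tr; have [d1 d2] := smooth_on_derivable_s sm (conj tr rr0).
  have D1 : is_derive t 1 (phi r) (partial_s phi r t).
    by rewrite /partial_s derive1E; apply: DeriveDef.
  have D2 : is_derive t 1 (partial_s phi r) (partial_s (partial_s phi) r t).
    by rewrite {2}/partial_s derive1E; apply: DeriveDef.
  refine (is_derive_eq (is_deriveB D1 (is_deriveM (is_derive_id (t : R) (1 : R)) D2)) _).
  by rewrite /GRing.scale /=; ring.
have r_ge0 : 0 <= r := le_trans (normr_ge0 s) sr.
have itv t : t \in `[- r, r] -> `|t| <= r by rewrite in_itv /= ler_norml.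
have [c cr cmin] : exists2 c, c \in `[- r, r] &
    forall t, t \in `[- r, r] -> h c <= h t.
  apply: EVT_min; first by rewrite ge0_cp.
  by apply: derivable_within_continuous => t /itv /dh [].
apply: (lt_le_trans _ (cmin s _)); last by rewrite in_itv /= -ler_norml.
have crn := itv _ cr.
(* Where this product vanishes, [h] equals the regularity expression. It does so at an endpoint, and
   at an interior critical point other than 0. *)
have hreg : (r ^+ 2 - c ^+ 2) * partial_s (partial_s phi) r c = 0 -> 0 < h c.
  by move=> E; have := reg0 r c (conj crn rr0); rewrite /regularity_expr E addr0.
have [c0|c0] := eqVneq c 0.
  by rewrite /h c0 mul0r subr0; apply: phi0; split; rewrite /= ?normr0.
have [cr'|cr'] := ltP `|c| r; last first.
  have cE : `|c| = r by apply/le_anti; rewrite crn.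
  by apply: hreg; rewrite -cE real_normK ?num_real// subrr mul0r.
have h'c : is_derive c 1 h 0.
  apply: (@derive1_at_min _ _ (- r) r); first by rewrite ge0_cp.
  - by move=> t; rewrite in_itv /= => /andP[/ltW a /ltW b]; have [] := dh t _;
      rewrite // ler_norml a.
  - by rewrite in_itv /= -ltr_norml.
  - by move=> t; rewrite in_itv /= => /andP[/ltW a /ltW b]; apply: cmin;
      rewrite in_itv /= a.
have := derive_val (is_derive := dh c crn).
rewrite (derive_val (is_derive := h'c)) => /esym/eqP.
rewrite oppr_eq0 mulf_eq0 (negbTE c0) /= => /eqP E.
by apply: hreg; rewrite E mulr0.
Qed.

(** * The coframe of the surface and the frame dual to it *)

Theorem theorem2 (R : realType) (r0 : R) (phi : R -> R -> R) (hr0 : 0 < r0)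
    (hphi : spherically_symmetric_finsler_surface r0 phi)
    (x y : 'rV[R]_2) (hx : enorm x < r0) (hxy : free [:: x; y]) :
  let F := sphF phi in
  let g := metric_tensor F x y in
  let r := enorm x in
  let u := enorm y in
  let s := svar x y in
  let a := acoef phi r s in
  let n := nvec x y in
  let m_low := a *: n in
  let l := (F x y)^-1 *: y in
  let m := a *: (rho0 phi r s *: n
                 + ((r ^+ 2 - s ^+ 2) / u)
                   *: (rho2 phi r s *: y + (u * rho3 phi r s) *: x)) in
  [/\ g \in unitmx,
      raise g m_low = m,
      orthonormal_frame g l m
    & berwald_frame F x y l m].
Proof.
move=> F g r u s a n m_low l m.
have [y0 c0] := free_cross hxy.
have u0 : u != 0 by rewrite gt_eqF ?enorm_gt0.
have sr : `|s| <= r := svar_le x y0.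
have d0 : 0 < r ^+ 2 - s ^+ 2 := svar_lt y0 c0.
have h0 := finsler_sub_s_partial_gt0 hphi sr hx.
have [sm phi0 reg0] := hphi.
have {}phi0 : 0 < phi r s by apply: phi0.
have {}reg0 := reg0 r s (conj sr hx).
have a2 : a ^+ 2 = phi r s * regularity_expr phi r s / (r ^+ 2 - s ^+ 2).
  by rewrite sqr_sqrtr// divr_ge0 ?mulr_ge0// ltW.
(* The gradient of F in y, which is the covector obtained by lowering the index of [l]. *)
pose L := (phi r s / u) *: y + partial_s phi r s *: n.
have gE : g = L^T *m L + m_low^T *m m_low.
  apply/matrixP => i j; rewrite mxE partial_partial_sphF2//; last first.
  - by move=> t tr; have [] := smooth_on_derivable_s sm (conj tr hx).
  - by move=> t tr; have [] := smooth_on_derivable_s sm (conj tr hx).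
  have nn : n 0 i * n 0 j = _ := nvec_outer x i j y0.
  (* Solved for the projection, this turns the last two terms of the Hessian into one multiple of
     n_i n_j, with coefficient phi (phi - s phi_s) / (r^2 - s^2) + phi phi_ss, which is [a ^+ 2]. *)
  have {}nn : (i == j)%:R - y 0 i * y 0 j / u ^+ 2
              = n 0 i * n 0 j / (r ^+ 2 - s ^+ 2).
    by rewrite nn [RHS]mulrC mulKf // (gt_eqF d0).
  rewrite -/n -/u -/r -/s nn.
  have outer (w : 'rV[R]_2) : (w^T *m w) i j = w 0 i * w 0 j.
    by rewrite mxE big_ord1 mxE.
  have LE k : L 0 k = phi r s * y 0 k / u + partial_s phi r s * n 0 k.
    by rewrite /L 3!mxE mulrAC.
  have mE k : m_low 0 k = a * n 0 k by rewrite mxE.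
  rewrite [RHS]mxE !outer !LE !mE.
  have -> : a * n 0 i * (a * n 0 j) = a ^+ 2 * (n 0 i * n 0 j) by ring.
  by rewrite a2 /regularity_expr; field; rewrite u0 gt_eqF.
have yy : dot y y = u ^+ 2 by rewrite sqr_enorm.
have xy : dot x y = s * u := dot_svar x y0.
have ny : dot n y = 0 by rewrite dot_nvec yy xy -/s -/u; field.
have nn : dot n n = r ^+ 2 - s ^+ 2.
  rewrite [LHS]dot_nvec [dot y n]dotC ny [dot x n]dotC dot_nvec.
  by rewrite [dot y x]dotC xy -sqr_enorm -/r -/s -/u; field.
have xE : x = n + (s / u) *: y by rewrite subrK.
(* In the orthogonal basis n, y the factor phi - s phi_s cancels: rho0 + (r^2 - s^2) rho3 is 1 /
   (phi E) and rho2 + s rho3 is - phi_s / (phi^2 E), where E is the regularity expression. *)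
have mE : m = (a / (phi r s * regularity_expr phi r s)) *: n
    + (- (a * (r ^+ 2 - s ^+ 2) * partial_s phi r s
       / (phi r s ^+ 2 * regularity_expr phi r s) / u)) *: y.
  rewrite /m; clearbody n.
  rewrite xE; apply/rowP => k; rewrite !mxE /rho0 /rho2 /rho3.
  move: h0 reg0; rewrite /regularity_expr => h0 reg0.
  by field; rewrite u0 !gt_eqF.
have [gpos gm go] : [/\ positive_definite g, raise g m_low = m
    & orthonormal_frame g l m].
  have LE v : dot L v = phi r s / u * dot y v + partial_s phi r s * dot n v.
    by rewrite dotC dotDr !dotZr ![dot v _]dotC.
  have ME v : dot m_low v = a * dot n v by rewrite dotC dotZr dotC.
  have Fl : F x y = u * phi r s by [].
  rewrite gE; apply: dual_coframe; rewrite ?LE ?ME ?mE ?dotDr !dotZr ?Fl.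
  - by rewrite yy ny; field; rewrite u0 gt_eqF.
  - by rewrite ny !mulr0.
  (* The y-component of [m] exactly offsets the phi_s n part of [L]. *)
  - by rewrite [dot y n]dotC ny nn yy; field; rewrite u0 !gt_eqF.
  (* This pairing is a^2 (r^2 - s^2) / (phi E), with E the regularity expression; it fixes the
     normalization of [a]. *)
  - rewrite nn ny mulr0 addr0 mulrA [a * (a / _)]mulrA -expr2 a2.
    by field; rewrite !gt_eqF.
split=> //; first exact: positive_definite_unitmx.
by have [? []] := go; split.
Qed.
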